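(* Let $X \neq \{0\}$ be a real Banach space with the Daugavet property. Then there exist convex closed bounded sets $A, D \subset X$ such that $A$ and $D$ are SCD but the intersection $A \cap D$ is not SCD.
   Context: All Banach spaces are real. For a non-empty bounded set $A \subset X$, a slice of $A$ is a (non-empty) set of the form $S(A,x^*,\varepsilon)=\{x\in A : x^*(x) > \sup_{a\in A} x^*(a)-\varepsilon\}$ with $x^*\in X^*\setminus\{0\}$ and $\varepsilon>0$. A sequence $(U_n)_{n\in\mathbb N}$ of non-empty subsets of a bounded set $A\subset X$ is called determining (for $A$) if for every $B\subset X$ with $B\cap U_n\neq\emptyset$ for all $n$ one has $A\subset\overline{\mathrm{conv}}(B)$ (norm-closed convex hull). A bounded set $A$ is SCD (slicely countably determined) if it has a determining sequence consisting of slices of $A$. A Banach space $X$ has the Daugavet property if every bounded linear rank-one operator $T\colon X\to X$ satisfies $\|I+T\|=1+\|T\|$. *)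

(* Defs.v *)
From mathcomp Require Import all_boot all_order all_algebra.
From mathcomp Require Import all_classical all_reals all_analysis.

Set Implicit Arguments.
Unset Strict Implicit.
Unset Printing Implicit Defensive.

Import Order.TTheory GRing.Theory Num.Theory.
Import numFieldNormedType.Exports.

Local Open Scope classical_set_scope.
Local Open Scope ring_scope.

(* The supremum of a set of reals is the true one only when the set is nonempty
   and bounded above, so [opnorm] is meaningful for bounded operators only. *)
Definition opnorm {R : realType} {X : normedModType R} (T : X -> X) : R :=
  sup [set `|T x| | x in [set x : X | `|x| <= 1]].

Definition rank_one {R : realType} {X : normedModType R} (T : X -> X) : Prop :=
  exists2 e : X, e != 0 & range T = range (fun a : R => a *: e).

(* For linear maps boundedness is stated as continuity, see
   [linear_bounded_continuous]. *)
Definition daugavet {R : realType} (X : normedModType R) : Prop :=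
  forall T : {linear X -> X}, continuous T -> rank_one T ->
    opnorm (fun x => x + T x) = 1 + opnorm T.

Definition slice {R : realType} {X : normedModType R}
    (A : set X) (f : X -> R) (eps : R) : set X :=
  [set x | A x /\ sup (f @` A) - eps < f x].

Definition is_slice {R : realType} {X : normedModType R}
    (A S : set X) : Prop :=
  exists (f : {linear X -> R^o}) (eps : R),
    [/\ continuous f, exists x, f x != 0, 0 < eps & S = slice A f eps].

Definition closed_conv {R : realType} {X : normedModType R}
    (B : set X) : set X :=
  closure (smallest (@convex_set R X) B : set X).

Definition determining {R : realType} {X : normedModType R}
    (A : set X) (U : nat -> set X) : Prop :=
  (forall n, U n !=set0 /\ U n `<=` A) /\
  (forall B : set X, (forall n, B `&` U n !=set0) -> A `<=` closed_conv B).

(* The empty set is not SCD: it has no nonempty slices. *)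
Definition scd {R : realType} {X : normedModType R} (A : set X) : Prop :=
  bounded_set A /\
  exists U : nat -> set X, (forall n, is_slice A (U n)) /\ determining A U.

(* Main.v *)
From HB Require Import structures.
Require Import Defs.
From mathcomp Require Import all_boot all_order all_algebra.
From mathcomp Require Import all_classical all_reals all_analysis.
From mathcomp Require Import ring lra.

Set Implicit Arguments.
Unset Strict Implicit.
Unset Printing Implicit Defensive.

Import Order.TTheory GRing.Theory Num.Theory.
Import numFieldNormedType.Exports.

Local Open Scope classical_set_scope.
Local Open Scope ring_scope.

(** Let W be the closed convex hull of countably many points xi_n of the unit
    ball, chosen so that every slice of W contains some xi_k that is almost
    l1-orthogonal to any prescribed vector x0 - y_0 - ... - y_(n-1), where
    x0 and the y's are among the xi's and |x0| = 1.  Given countably many slices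
    of W, one can pick y_n in the n-th one so that
    |x0 - y_0 - ... - y_(n-1)| >= n + 1/2 for all n.  The functional norming
    this vector is at least 1/2 at x0 and at most 0 at y_0, ..., y_(n-1), so x0
    stays at distance at least 1/2 from the convex hull of the y's, and W is not
    SCD ([daugavet_sequence_not_scd]).

    Choose also vectors e_n tending to 0 and functionals f_n that are
    biorthogonal to them and vanish on W.  Let A be the closed convex hull of
    the points xi_n + e_(2n) and xi_n - e_(2n), and D that of the points
    xi_n + e_(2n+1) and xi_n - e_(2n+1).  The functionals f_(2n) and - f_(2n)
    strongly expose the former points in A, so the small slices around these
    points determine A ([spiky_hull_scd]), although A contains W.  The same
    holds for D.  All f_(2n) vanish on D, and because e_n tends to 0, the points
    of A at which all f_(2n) vanish belong to W ([spiky_hull_kernel]).  Hence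
    the intersection of A and D is W.

    The xi_n, e_n and f_n are built together in stages: the new points must be
    in the kernels of the functionals chosen before, and each new functional
    must vanish at the points chosen before.  The Daugavet property yields, in
    every slice of the unit ball and for every u, some z with |u - z| close to
    |u| + 1 ([daugavet_slice]).  Averages of such z, each taken in the slice
    that pulls the running average towards a given x, are almost l1-orthogonal
    to u and lie in any prescribed weak neighbourhood of x
    ([daugavet_weak_nbhs]).  Small corrections then move them to subspaces of
    finite codimension, and separation by functionals shows that x is almost a
    convex combination of such points ([daugavet_approx]).  This is what every
    slice of W needs to contain one of them. *)

(** * Bounded linear functionals *)

Section BoundedLinear.
Context {R : realType} {X : normedModType R}.
Implicit Types (f g : X -> R) (x y : X).

(** Functionals are kept as plain functions satisfying a predicate, so that
    linear combinations of them need no bundling; [bounded_linear_bundle] and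
    [continuous_bounded_linear] convert to and from bundled maps. *)
Definition bounded_linear f : Prop :=
  (forall a x y, f (a *: x + y) = a * f x + f y) /\
  exists M, forall x, `|f x| <= M * `|x|.

Lemma bounded_linear0 f : bounded_linear f -> f 0 = 0.
Proof.
move=> [lf _]; have := lf 1 0 0; rewrite scale1r addr0 mul1r => /eqP.
by rewrite -subr_eq0 opprD addNKr oppr_eq0 => /eqP.
Qed.

Lemma bounded_linearZ f a x : bounded_linear f -> f (a *: x) = a * f x.
Proof.
by move=> bf; have [lf _] := bf; have := lf a x 0; rewrite (bounded_linear0 bf) !addr0.
Qed.

Lemma bounded_linearD f x y : bounded_linear f -> f (x + y) = f x + f y.
Proof. by move=> [lf _]; have := lf 1 x y; rewrite scale1r mul1r. Qed.

Lemma bounded_linearN f x : bounded_linear f -> f (- x) = - f x.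
Proof. by move=> bf; rewrite -scaleN1r bounded_linearZ// mulN1r. Qed.

Lemma bounded_linearB f x y : bounded_linear f -> f (x - y) = f x - f y.
Proof. by move=> bf; rewrite bounded_linearD// bounded_linearN. Qed.

Lemma bounded_linear_sum f (I : Type) (s : seq I) (F : I -> X) :
  bounded_linear f -> f (\sum_(i <- s) F i) = \sum_(i <- s) f (F i).
Proof.
move=> bf; elim: s => [|i s IH]; first by rewrite !big_nil (bounded_linear0 bf).
by rewrite !big_cons bounded_linearD// IH.
Qed.

Lemma bounded_linear_cst0 : bounded_linear (fun=> 0).
Proof.
split=> [a x y|]; first by rewrite mulr0 addr0.
by exists 0 => x; rewrite normr0 mul0r.
Qed.

Lemma bounded_linear_comb f g a :
  bounded_linear f -> bounded_linear g -> bounded_linear (fun x => a * f x + g x).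
Proof.
move=> [lf [M fM]] [lg [N gN]]; split.
  by move=> b x y; rewrite lf lg; ring.
exists (`|a| * M + N) => x.
rewrite (le_trans (ler_normD _ _))// normrM mulrDl lerD// -mulrA.
exact: ler_wpM2l.
Qed.

Lemma bounded_linear_scale f a : bounded_linear f -> bounded_linear (fun x => a * f x).
Proof.
move=> bf; have := bounded_linear_comb a bf bounded_linear_cst0.
by under eq_fun do rewrite addr0.
Qed.

Lemma bounded_linear_sumf (I : eqType) (s : seq I) (F : I -> X -> R) (c : I -> R) :
  (forall i, i \in s -> bounded_linear (F i)) ->
  bounded_linear (fun x => \sum_(i <- s) c i * F i x).
Proof.
elim: s => [|i s IH] bF.
  by under eq_fun do rewrite big_nil; exact: bounded_linear_cst0.
under eq_fun do rewrite big_cons; apply: bounded_linear_comb.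
  by apply: bF; rewrite inE eqxx.
by apply: IH => j js; apply: bF; rewrite inE js orbT.
Qed.

Lemma bounded_linear_bound f : bounded_linear f ->
  exists2 M, 0 < M & forall x, `|f x| <= M * `|x|.
Proof.
move=> [_ [M fM]]; exists (`|M| + 1) => [|x]; first by rewrite ltr_wpDl.
by rewrite (le_trans (fM x))// ler_wpM2r// (le_trans (ler_norm M))// lerDl.
Qed.

Lemma bounded_linear_bundle f :
  bounded_linear f -> exists2 g : {linear X -> R^o}, continuous g & f = g :> (X -> R).
Proof.
move=> bf; have [lf [M fM]] := bf.
have lf' : linear (f : X -> R^o) by move=> a x y; rewrite lf.
pose L := GRing.isLinear.Build R X R^o _ (f : X -> R^o) lf'.
pose g : {linear X -> R^o} := HB.pack (f : X -> R^o) L.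
exists g => //; apply/linear_bounded_continuous/linear_boundedP.
near=> r => x; rewrite (le_trans (fM x))// ler_wpM2r//.
Unshelve. all: by end_near. Qed.

Lemma continuous_bounded_linear (g : {linear X -> R^o}) :
  continuous g -> bounded_linear g.
Proof.
move=> /linear_bounded_continuous/linear_boundedP gb.
split=> [a x y|]; first by rewrite linearP.
by have [r r0 gr] := pinfty_ex_gt0 gb; exists r.
Qed.

End BoundedLinear.

(** * The Hahn-Banach theorem *)

Section HahnBanach.
Context {R : realType} {X : lmodType R}.
Implicit Types (p q : X -> R) (C : set (X * R)).

Definition sublinear p : Prop :=
  (forall x y, p (x + y) <= p x + p y) /\
  (forall (t : R) x, 0 < t -> p (t *: x) <= t * p x).

Lemma sublinear0 p : sublinear p -> 0 <= p 0.
Proof. by move=> [pD _]; have := pD 0 0; rewrite addr0 -lerBlDl subrr. Qed.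

Lemma sublinear_ge p x y : sublinear p -> p x - p (- y) <= p (x + y).
Proof.
by move=> [pD _]; rewrite lerBlDr; have := pD (x + y) (- y); rewrite addrK.
Qed.

Lemma inf_approx (E : set R) (a : R) :
  E !=set0 -> has_lbound E -> inf E < a -> exists2 e, E e & e < a.
Proof.
move=> E0 lE; rewrite -subr_gt0 => /inf_adherent/(_ (conj E0 lE))[e Ee lt_e].
by exists e => //; rewrite addrCA subrr addr0 in lt_e.
Qed.

(** The infimum of q (x + w) - c over a convex cone of pairs (w, c) below the
    graph of q stays finite because q (x + w) >= q w - q (- x).  It serves
    twice: with the ray through (v, q v) it shows that minimal sublinear
    functions are additive, and with the cone spanned by a set at height d it
    produces separating functionals. *)
Lemma sublinear_cone_inf q C : sublinear q ->
  C (0, 0) ->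
  (forall u v, C u -> C v -> C (u.1 + v.1, u.2 + v.2)) ->
  (forall (t : R) u, 0 < t -> C u -> C (t *: u.1, t * u.2)) ->
  (forall u, C u -> u.2 <= q u.1) ->
  exists p, [/\ sublinear p, forall x, p x <= q x &
    forall u, C u -> p (- u.1) <= - u.2].
Proof.
move=> sq C0 CD CZ Cq; have [qD qZ] := sq.
have q00 : q 0 = 0.
  apply/eqP; rewrite eq_le sublinear0// andbT.
  by have := qZ 2^-1 0; rewrite invr_gt0 scaler0 => /(_ (ltr0Sn R 1)); lra.
pose E x := [set q (x + u.1) - u.2 | u in C].
have E0 x : E x !=set0 by exists (q (x + 0) - 0), (0, 0).
have lE x : has_lbound (E x).
  exists (- q (- x)) => _ [u Cu <-].
  by have := sublinear_ge u.1 x sq; have := Cq u Cu; rewrite [u.1 + x]addrC; lra.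
have le_E x u : C u -> inf (E x) <= q (x + u.1) - u.2.
  by move=> Cu; apply: ge_inf => //; exists u.
exists (fun x => inf (E x)); split; first split.
- move=> x y; apply/ler_addgt0Pr => e e0.
  have e2 : 0 < e / 2 by rewrite divr_gt0.
  have [_ [u Cu <-] ux] : exists2 a, E x a & a < inf (E x) + e / 2.
    by apply: inf_approx => //; rewrite ltrDl.
  have [_ [v Cv <-] vy] : exists2 a, E y a & a < inf (E y) + e / 2.
    by apply: inf_approx => //; rewrite ltrDl.
  have := le_E (x + y) _ (CD u v Cu Cv) => /= /le_trans; apply.
  have := qD (x + u.1) (y + v.1); rewrite addrACA => qxy.
  by lra.
- move=> t x t0; rewrite -ler_pdivrMl//; apply: lb_le_inf => // _ [u Cu <-].
  rewrite ler_pdivrMl// (le_trans (le_E _ _ (CZ t u t0 Cu)))//=.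
  by rewrite -scalerDr mulrBr lerB// qZ.
- by move=> x; have := le_E x _ C0; rewrite /= addr0 subr0.
- by move=> u Cu; have := le_E (- u.1) _ Cu; rewrite addNr q00 sub0r.
Qed.

(** Zorn's lemma applies because the pointwise infimum of a chain of sublinear
    functions is sublinear: subadditivity involves two members of the chain at a
    time, and the smaller one serves for both. *)
Lemma sublinear_minimal p : sublinear p ->
  exists2 q, sublinear q /\ (forall x, q x <= p x) &
    forall r, sublinear r -> (forall x, r x <= q x) -> r = q.
Proof.
move=> sp.
pose T := {q : X -> R | sublinear q /\ forall x, q x <= p x}.
pose le (q r : T) := `[< forall x, sval r x <= sval q x >].
have [|q r s|q r||q qmin] := @Zorn T le.
- by move=> q; apply/asboolP.
- by move=> /asboolP qr /asboolP rs; apply/asboolP => x; exact: le_trans (qr x).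
- case: q r => [q Pq] [r Pr] /asboolP/= qr /asboolP/= rq.
  have qE : q = r by apply/funext => x; apply/eqP; rewrite eq_le qr rq.
  by subst r; congr exist; exact: Prop_irrelevance.
- move=> A Atot.
  have [->|/set0P[a Aa]] := eqVneq A set0.
    by exists (exist _ p (conj sp (fun x => lexx _))).
  pose E x := [set sval q x | q in A].
  have E0 x : E x !=set0 by exists (sval a x), a.
  have lE x : has_lbound (E x).
    exists (- p (- x)) => _ [q Aq <-]; have [sq qp] := svalP q.
    have := sublinear_ge 0 x sq; rewrite add0r.
    by have := sublinear0 sq; have := qp (- x); lra.
  have le_E x (q : T) : A q -> inf (E x) <= sval q x.
    by move=> Aq; apply: ge_inf => //; exists q.
  suff si : sublinear (fun x => inf (E x)) /\ forall x, inf (E x) <= p x.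
    by exists (exist (fun q => sublinear q /\ forall x, q x <= p x) _ si) => q Aq; apply/asboolP => x /=; exact: le_E.
  split; [split|].
  + move=> x y; apply/ler_addgt0Pr => e e0.
    have e2 : 0 < e / 2 by rewrite divr_gt0.
    have [_ [q Aq <-] qx] : exists2 b, E x b & b < inf (E x) + e / 2.
      by apply: inf_approx => //; rewrite ltrDl.
    have [_ [r Ar <-] ry] : exists2 b, E y b & b < inf (E y) + e / 2.
      by apply: inf_approx => //; rewrite ltrDl.
    have [/asboolP rq|/asboolP qr] := Atot _ _ Aq Ar.
      have [[rD _] _] := svalP r; have := le_E (x + y) r Ar.
      by have := rD x y; have := rq x; lra.
    have [[qD _] _] := svalP q; have := le_E (x + y) q Aq.
    by have := qD x y; have := qr y; lra.
  + move=> t x t0; rewrite -ler_pdivrMl//; apply: lb_le_inf => // _ [q Aq <-].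
    have [[_ qZ] _] := svalP q.
    by rewrite ler_pdivrMl// (le_trans (le_E _ _ Aq))// qZ.
  + by move=> x; have [_ ap] := svalP a; rewrite (le_trans (le_E x a Aa)).
- have [sq qp] := svalP q; exists (sval q) => // r sr rq.
  have rp x : r x <= p x by rewrite (le_trans (rq x)).
  have /(_ _)/(congr1 sval) := qmin (exist _ r (conj sr rp)); apply.
  exact/asboolP.
Qed.

(** A minimal sublinear function is linear: lowering it along the ray through
    (v, q v) gives a sublinear function below it, hence q itself, and this forces
    q (- v) <= - q v. *)
Lemma hahn_banach p : sublinear p ->
  exists2 f : X -> R, (forall a x y, f (a *: x + y) = a * f x + f y) &
    forall x, f x <= p x.
Proof.
move=> sp; have [q [sq qp] qmin] := sublinear_minimal sp; exists q => //.
have [qD qZ] := sq.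
have q_pos t x : 0 < t -> q (t *: x) = t * q x.
  move=> t0; apply/eqP; rewrite eq_le qZ//= -ler_pdivlMl//.
  have := qZ t^-1 (t *: x); rewrite scalerA mulVf ?gt_eqF// scale1r invr_gt0.
  exact.
have q0 : q 0 = 0.
  by have := q_pos 2 0 (ltr0Sn R 1); rewrite scaler0; lra.
have qadd x v : q (x + v) = q x + q v.
  apply/eqP; rewrite eq_le qD/= addrC.
  pose C : set (X * R) := [set u | exists2 t, 0 <= t & u = (t *: v, t * q v)].
  have [||||r [sr rq rC]] := @sublinear_cone_inf q C sq.
  - by exists 0; rewrite ?scale0r ?mul0r.
  - move=> _ _ [s s0 ->] [t t0 ->]; exists (s + t); first exact: addr_ge0.
    by rewrite scalerDl mulrDl.
  - move=> s _ s0 [t t0 ->]; exists (s * t); first by rewrite mulr_ge0// ltW.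
    by rewrite scalerA mulrA.
  - move=> _ [t t0 ->] /=; have [<-|tn0] := eqVneq 0 t.
      by rewrite scale0r mul0r q0.
    by rewrite q_pos// lt_neqAle tn0.
  (* By minimality of q, the function lowered along the ray is q itself. *)
  have rE := qmin r sr rq; rewrite rE in rC.
  have : q (- v) <= - q v by apply: (rC (v, q v)); exists 1; rewrite ?scale1r ?mul1r.
  have := qD (x + v) (- v); rewrite addrK; lra.
have qN x : q (- x) = - q x.
  by apply/eqP; rewrite -subr_eq0 opprK -qadd addNr q0.
move=> a x y; rewrite qadd; congr (_ + _).
have [a0|a0|->] := ltgtP a 0; last by rewrite scale0r mul0r.
- by rewrite -[a *: x]opprK -scaleNr qN q_pos ?oppr_gt0// mulNr opprK.
- exact: q_pos.
Qed.

End HahnBanach.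

(** * Separation by functionals *)

Section Separation.
Context {R : realType} {X : normedModType R}.
Implicit Types (G : set X) (f : X -> R).

(** The real index is the total weight of the combination. *)
Inductive conic_comb G : R -> X -> Prop :=
| conic_comb0 : conic_comb G 0 0
| conic_combS a v t w :
    conic_comb G a v -> 0 <= t -> G w -> conic_comb G (a + t) (v + t *: w).

Lemma conic_combD G a v b w :
  conic_comb G a v -> conic_comb G b w -> conic_comb G (a + b) (v + w).
Proof.
move=> av; elim=> [|b' w' t z _ IH t0 Gz]; first by rewrite !addr0.
by rewrite !addrA; exact: conic_combS.
Qed.

Lemma conic_combZ G s a v :
  0 <= s -> conic_comb G a v -> conic_comb G (s * a) (s *: v).
Proof.
move=> s0; elim=> [|b w t z _ IH t0 Gz]; first by rewrite mulr0 scaler0; exact: conic_comb0.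
by rewrite mulrDr scalerDr scalerA; apply: conic_combS => //; exact: mulr_ge0.
Qed.

(** The hypothesis says that 0 is at distance at least d from the convex hull
    of G.  The sublinear function is the infimum of |x + v| - a * d over the
    conic combinations v of G of total weight a. *)
Lemma separation G d :
  (forall a v, conic_comb G a v -> a * d <= `|v|) ->
  exists f, [/\ bounded_linear f, forall x, `|f x| <= `|x| &
    forall w, G w -> d <= f w].
Proof.
move=> Gd.
pose C : set (X * R) := [set u | exists2 a, conic_comb G a u.1 & u.2 = a * d].
have snorm : sublinear (fun x : X => `|x|).
  by split=> [x y|t x t0]; [exact: ler_normD|rewrite normrZ gtr0_norm].
have [||||p [sp pn pC]] := @sublinear_cone_inf _ _ _ C snorm.
- by exists 0; [exact: conic_comb0|rewrite mul0r].
- move=> [v c] [w e] [a /= av ->] [b /= bw ->].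
  by exists (a + b); [exact: conic_combD|rewrite mulrDl].
- move=> t [v c] /ltW t0 [a /= av ->].
  by exists (t * a); [exact: conic_combZ|rewrite mulrA].
- by move=> [v c] [a /= av ->]; exact: Gd.
have [f lf fp] := hahn_banach sp; exists f.
have fN x : f (- x) = - f x.
  have f0 : f 0 = 0 by have := lf 1 0 0; rewrite scale1r addr0; lra.
  by have := lf (-1) x 0; rewrite scaleN1r !addr0 f0; lra.
have fn x : `|f x| <= `|x|.
  rewrite ler_norml (le_trans (fp x) (pn x)) andbT lerNl -fN.
  by rewrite (le_trans (fp _))// (le_trans (pn _))// normrN.
split=> //; first by split => //; exists 1 => x; rewrite mul1r.
move=> w Gw; rewrite -lerN2 -fN (le_trans (fp _))//.
apply: (pC (w, d)); exists 1; rewrite ?mul1r//=.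
by have := conic_combS (conic_comb0 G) ler01 Gw; rewrite !add0r scale1r.
Qed.

Lemma norming_functional v :
  exists f, [/\ bounded_linear f, forall x, `|f x| <= `|x| & f v = `|v|].
Proof.
have [|f [bf fn fv]] := @separation [set v] `|v|.
  move=> a w; suff : conic_comb [set v] a w -> 0 <= a /\ w = a *: v.
    by move=> /[apply] -[a0 ->]; rewrite normrZ ger0_norm.
  elim=> [|b u t z _ [b0 ->] t0 ->]; first by rewrite scale0r.
  by rewrite scalerDl addr_ge0.
exists f; split=> //; apply/eqP; rewrite eq_le (fv v)//.
by rewrite andbT (le_trans (ler_norm _)).
Qed.

(** A value of f at a conic combination is a weighted sum of its values at
    finitely many points, which depend on the combination only and not on f. *)
Lemma conic_comb_mean G a v : conic_comb G a v ->
  exists2 s : seq X, (forall w, w \in s -> G w) &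
    forall f b, bounded_linear f -> (forall w, w \in s -> b <= f w) ->
      a * b <= f v.
Proof.
elim=> [|b v' t z _ [s sG sf] t0 Gz].
  by exists [::] => // f b bf _; rewrite mul0r bounded_linear0.
exists (z :: s) => [w|f c bf fs].
  by rewrite inE => /predU1P[->//|]; exact: sG.
rewrite mulrDl (bounded_linearD _ _ bf) (bounded_linearZ _ _ bf) lerD//.
  by apply: sf => // w ws; apply: fs; rewrite inE ws orbT.
by rewrite ler_wpM2l// fs// inE eqxx.
Qed.

End Separation.

(** * Slices of the unit ball of a Daugavet space *)

Section DaugavetSlices.
Context {R : realType} {X : normedModType R}.
Implicit Types (f : X -> R) (x y z : X).

Lemma tensor_linear f y : bounded_linear f ->
  exists2 T : {linear X -> X}, continuous T & forall x, T x = f x *: y.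
Proof.
move=> bf; have [lf [M fM]] := bf.
pose t x := f x *: y.
have lt : linear t by move=> a x z; rewrite /t lf scalerDl scalerA.
pose L := GRing.isLinear.Build R X X _ t lt.
pose T : {linear X -> X} := HB.pack t L.
exists T => //; apply/linear_bounded_continuous/linear_boundedP.
near=> r => x; rewrite [T x]/(t x) normrZ.
rewrite (le_trans (ler_wpM2r _ (fM x)))// mulrAC ler_wpM2r//.
Unshelve. all: by end_near. Qed.

Lemma sup_gt_approx (E : set R) (a : R) :
  0 < sup E -> a < sup E -> exists2 e, E e & a < e.
Proof.
move=> E0 aE; have hE : has_sup E.
  by apply: contrapT => /sup_out E00; rewrite E00 ltxx in E0.
have /sup_adherent/(_ hE) : 0 < sup E - a by rewrite subr_gt0.
by move=> [e Ee]; rewrite opprB addrCA subrr addr0; exists e.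
Qed.

Context (dX : daugavet X).

(** If s is the norm of f, the operator T x = (f x / s) y has norm |y|, so some
    z in the ball satisfies |z + T z| close to 1 + |y|.  This forces |f z| to be
    close to s; up to the sign of z, T z is close to y and z lies in the slice. *)
Lemma daugavet_slice_neq0 y f x (e : R) : y != 0 -> bounded_linear f ->
  `|x| <= 1 -> 0 < e ->
  exists z, [/\ `|z| <= 1, f x - e <= f z & `|y| + 1 - e <= `|y + z|].
Proof.
move=> y0 bf x1 e0; have [|] := pselect (forall v, f v = 0).
  move=> f0; exists (`|y|^-1 *: y); rewrite !f0; split.
  - by rewrite normrZ normfV normr_id mulVf// normr_eq0.
  - by rewrite sub0r oppr_le0 ltW.
  - have -> : y + `|y|^-1 *: y = (1 + `|y|^-1) *: y by rewrite scalerDl scale1r.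
    rewrite normrZ ger0_norm ?addr_ge0// ?invr_ge0// mulrDl mul1r mulVf ?normr_eq0//.
    by rewrite gerBl ltW.
move=> /existsNP[v /eqP fv0]; have [M M0 fM] := bounded_linear_bound bf.
have yp : 0 < `|y| by rewrite normr_gt0.
pose E := [set `|f z| | z in [set z : X | `|z| <= 1]].
have hE : has_sup E.
  split; first by exists `|f 0|, 0 => //=; rewrite normr0.
  exists M => _ [z z1 <-]; rewrite (le_trans (fM z))// -[leRHS]mulr1.
  by rewrite ler_wpM2l// ltW.
pose s := sup E.
have le_s z : `|z| <= 1 -> `|f z| <= s.
  by move=> z1; apply: sup_upper_bound => //; exists z.
have v0 : 0 < `|v|.
  by rewrite normr_gt0; apply: contraNneq fv0 => ->; rewrite bounded_linear0.
have s0 : 0 < s.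
  apply: lt_le_trans (le_s (`|v|^-1 *: v) _).
    by rewrite normr_gt0 bounded_linearZ// mulf_neq0// invr_eq0 gt_eqF.
  by rewrite normrZ normfV normr_id mulVf// gt_eqF.
have [T cT TE] := tensor_linear y (bounded_linear_scale s^-1 bf).
have rT : rank_one T.
  exists y => //; apply/seteqP; split=> _ [z _ <-]; first by exists (s^-1 * f z); rewrite ?TE.
  exists ((s * z / f v) *: v) => //.
  by rewrite TE bounded_linearZ// divfK// mulrA mulVf ?mul1r// gt_eqF.
have TM z : `|T z| = `|f z| / s * `|y|.
  by rewrite TE normrZ normrM normfV (gtr0_norm s0) [_^-1 * _]mulrC.
have yT : `|y| <= opnorm T.
  have hT : has_ubound [set `|T z| | z in [set z : X | `|z| <= 1]].
    exists `|y| => _ [z z1 <-]; rewrite TM -[leRHS]mul1r ler_wpM2r//.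
    by rewrite ler_pdivrMr// mul1r le_s.
  suff : s <= opnorm T * s / `|y|.
    by rewrite ler_pdivlMr// mulrC ler_pM2r.
  apply: ge_sup => [|_ [z z1 <-]]; first by case: hE.
  rewrite ler_pdivlMr// -ler_pdivrMr// mulrAC -TM.
  by apply: ub_le_sup => //; exists z.
have dT := dX cT rT.
(* The first bound controls the norm of y + z, the second one the value f z. *)
pose e' := Num.min (e / 2) (e * `|y| / s).
have e'0 : 0 < e' by rewrite lt_min !divr_gt0// mulr_gt0.
have [_ [z z1 <-] zT] : exists2 a,
    [set `|z + T z| | z in [set z : X | `|z| <= 1]] a & 1 + opnorm T - e' < a.
  apply: sup_gt_approx; rewrite -/(opnorm _) dT; last by rewrite ltrBlDr ltrDl.
  by rewrite addr_gt0// (lt_le_trans yp).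
wlog fz0 : z z1 zT / 0 <= f z => [H|].
  have [|fz0] := leP 0 (f z); first exact: H.
  apply: (H (- z)); rewrite /= ?normrN//.
    by rewrite linearN -opprD normrN.
  by rewrite bounded_linearN// oppr_ge0 ltW.
have fzs : f z / s <= 1 by rewrite ler_pdivrMr// mul1r (le_trans (ler_norm _)) ?le_s.
have ee : e' <= e / 2 by rewrite ge_min lexx.
have es : e' <= e * `|y| / s by rewrite ge_min lexx orbT.
have fzl : 1 - e' / `|y| <= f z / s.
  rewrite -(ler_pM2r yp) mulrBl divfK ?gt_eqF// mul1r.
  have := ler_normD z (T z); rewrite TM (ger0_norm fz0).
  by have : `|z| <= 1 := z1; lra.
exists z; split=> //.
  have : 1 - e / s <= f z / s.
    apply: le_trans fzl; rewrite lerD2l lerN2 ler_pdivrMr//.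
    by rewrite mulrAC.
  rewrite ler_pdivlMr// mulrBl divfK ?gt_eqF// mul1r => /(le_trans _); apply.
  by rewrite lerD2r (le_trans (ler_norm _)) ?le_s.
have -> : y + z = (z + T z) + (1 - f z / s) *: y.
  rewrite TE scalerBl scale1r [s^-1 * _]mulrC -addrA [_ *: y + _]addrC subrK.
  by rewrite addrC.
have := lerB_normD (z + T z) ((1 - f z / s) *: y).
rewrite normrZ (ger0_norm (_ : 0 <= 1 - f z / s)) ?subr_ge0//.
have : (1 - f z / s) * `|y| <= e'.
  by rewrite -ler_pdivlMr//; lra.
lra.
Qed.

(** For y = 0, a nonzero y of norm e does as well. *)
Lemma daugavet_slice y f x (e : R) : (exists v : X, v != 0) ->
  bounded_linear f -> `|x| <= 1 -> 0 < e ->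
  exists z, [/\ `|z| <= 1, f x - e <= f z & `|y| + 1 - e <= `|y + z|].
Proof.
move=> [v v0] bf x1 e0; have [->|] := eqVneq y 0; last first.
  by move=> ?; exact: daugavet_slice_neq0.
have vp : 0 < `|v| by rewrite normr_gt0.
pose w := (e / `|v|) *: v.
have wE : `|w| = e by rewrite normrZ ger0_norm ?divfK ?gt_eqF// divr_ge0// ltW.
have [|z [z1 fz wz]] := @daugavet_slice_neq0 w f x e _ bf x1 e0.
  by rewrite -normr_eq0 wE gt_eqF.
exists z; split => //; rewrite normr0 !add0r.
have := ler_normD w z; rewrite wE in wz *; lra.
Qed.

End DaugavetSlices.

(** * Weak neighbourhoods in the unit ball of a Daugavet space *)

Section WeakNeighbourhoods.
Context {R : realType} {X : normedModType R}.
Implicit Types (f : X -> R) (x y z u : X) (fs : seq (X -> R)).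
Context (dX : daugavet X) (X_neq0 : exists v : X, v != 0).

Lemma sum_squares_bound fs (r : R) : (forall f, f \in fs -> bounded_linear f) ->
  exists2 D, 0 <= D & forall z, `|z| <= r -> \sum_(f <- fs) f z ^+ 2 <= D.
Proof.
elim: fs => [|f fs IH] bfs; first by exists 0 => // z _; rewrite big_nil.
have [|D D0 fsD] := IH; first by move=> g gfs; apply: bfs; rewrite inE gfs orbT.
have [M M0 fM] := bounded_linear_bound (bfs f (mem_head _ _)).
exists ((M * r) ^+ 2 + D) => [|z zr]; first by rewrite addr_ge0// sqr_ge0.
rewrite big_cons lerD ?fsD// -real_normK ?num_real// lerXn2r ?nnegrE//.
  by rewrite (le_trans _ (_ : M * `|z| <= _)) ?mulr_ge0 ?ler_wpM2l// ltW.
by rewrite (le_trans (fM z))// ler_wpM2l// ltW.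
Qed.

(** As in Blackwell's approachability theorem, w is a sum of k points of the
    ball, each chosen in the slice of the functional phi that decreases the sum
    of squares of the f (w - k x).  This sum therefore grows only linearly in k,
    while each point can also be chosen to add almost 1 to the norm of
    m u + w. *)
Lemma daugavet_approachability fs x u (m : nat) (e : R) :
  (forall f, f \in fs -> bounded_linear f) -> `|x| <= 1 -> 0 < e ->
  forall D, (forall z, `|z| <= 2 -> \sum_(f <- fs) f z ^+ 2 <= D) ->
  forall k : nat, exists w, [/\ `|w| <= k%:R,
    `|m%:R *: u| + k%:R * (1 - e) <= `|m%:R *: u + w| &
    \sum_(f <- fs) f (w - k%:R *: x) ^+ 2 <= k%:R * (2 * e + D)].
Proof.
move=> bfs x1 e0 D fsD; elim=> [|k [w [wk uw wD]]].
  exists 0; split; rewrite ?normr0// ?mul0r ?addr0//.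
  rewrite scale0r subr0 big_seq big1// => f ffs.
  by rewrite bounded_linear0 ?expr0n//; exact: bfs.
(* Up to a factor 2, phi is minus the derivative at v of the sum of squares. *)
pose v := w - k%:R *: x.
pose phi z := \sum_(f <- fs) - f v * f z.
have bphi : bounded_linear phi by exact: bounded_linear_sumf.
have [z [z1 phiz uz]] := daugavet_slice dX (m%:R *: u + w) X_neq0 bphi x1 e0.
have zx2 : `|z - x| <= 2 by rewrite (le_trans (ler_normB _ _))//; lra.
exists (w + z); rewrite -natr1; split.
- by rewrite (le_trans (ler_normD _ _))// lerD.
- by rewrite addrA mulrDl mul1r; lra.
have -> : w + z - (k%:R + 1) *: x = v + (z - x).
  by rewrite /v scalerDl scale1r opprD addrACA.
rewrite big_seq (eq_bigr (fun f => f v ^+ 2 + (- 2) * (- f v * f (z - x)) +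
    f (z - x) ^+ 2)); last first.
  by move=> f /bfs bf; rewrite (bounded_linearD v _ bf); ring.
rewrite -big_seq !big_split/= -mulr_sumr -/(phi (z - x)) mulrDl mul1r.
have := fsD _ zx2; rewrite (bounded_linearB _ _ bphi).
rewrite -/v in wD; lra.
Qed.

(** The average w / m of the m points given by [daugavet_approachability]
    satisfies |f (w / m) - f x|^2 = O(1 / m). *)
Lemma daugavet_weak_nbhs fs x u (e : R) :
  (forall f, f \in fs -> bounded_linear f) -> `|x| <= 1 -> 0 < e ->
  exists y, [/\ `|y| <= 1, forall f, f \in fs -> `|f y - f x| <= e &
    `|u| + 1 - e <= `|u - y|].
Proof.
move=> bfs x1 e0.
have [D D0 fsD] := sum_squares_bound 2 bfs.
pose C := 2 * e + D.
have C0 : 0 <= C by rewrite addr_ge0// mulr_ge0// ltW.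
have [m mC] : exists m : nat, C / e ^+ 2 < m.+1%:R.
  by exists (Num.trunc (C / e ^+ 2)); rewrite truncnS_gt.
have m0 : 0 < m.+1%:R :> R by rewrite ltr0n.
have [w [wm uw wD]] := daugavet_approachability (- u) m.+1 bfs x1 e0 fsD m.+1.
exists (m.+1%:R^-1 *: w); split.
- by rewrite normrZ ger0_norm ?invr_ge0 ?ler0n// ler_pdivrMl// mulr1.
- move=> f ffs; have bf := bfs f ffs.
  have -> : f (m.+1%:R^-1 *: w) - f x = m.+1%:R^-1 * f (w - m.+1%:R *: x).
    rewrite (bounded_linearB _ _ bf) !(bounded_linearZ _ _ bf) mulrBr mulrA.
    by rewrite mulVf ?mul1r// gt_eqF.
  rewrite -(@ler_pXn2r _ 2)// ?nnegrE ?(ltW e0)// real_normK ?num_real// exprMn.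
  rewrite exprVn ler_pdivrMl ?exprn_gt0//.
  have : f (w - m.+1%:R *: x) ^+ 2 <= m.+1%:R * C.
    apply: le_trans wD; rewrite (big_rem f)//= lerDl sumr_ge0// => g _.
    exact: sqr_ge0.
  move/le_trans; apply; rewrite expr2 -mulrA ler_pM2l//.
  by rewrite -ler_pdivrMr ?exprn_gt0// ltW.
- have -> : u - m.+1%:R^-1 *: w = - (m.+1%:R^-1 *: (m.+1%:R *: - u + w)).
    by rewrite scalerDr scalerA mulVf ?gt_eqF// scale1r opprD opprK.
  rewrite normrN normrZ (@ger0_norm _ _^-1) ?invr_ge0 ?ler0n//.
  rewrite ler_pdivlMl//; apply: le_trans uw.
  by rewrite normrZ normrN ger0_norm ?ler0n// mulrBr mulrDr mulrBr mulr1 addrA.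
Qed.

End WeakNeighbourhoods.

(** * Biorthogonal systems and almost orthogonal convex combinations *)

Section Biorthogonal.
Context {R : realType} {X : normedModType R}.
Implicit Types (f g : X -> R) (x y z u : X) (b : seq (X * (X -> R))).

Fixpoint biorthogonal b : Prop :=
  if b is (e, f) :: b' then
    [/\ bounded_linear f, f e = 1,
        forall p, p \in b' -> f p.1 = 0 /\ p.2 e = 0 & biorthogonal b']
  else True.

Lemma biorthogonal_bounded b p : biorthogonal b -> p \in b -> bounded_linear p.2.
Proof.
elim: b => // -[e f] b IH [bf _ _ bb]; rewrite inE => /predU1P[->//|].
exact: IH.
Qed.

Definition annihilates b x := forall p, p \in b -> p.2 x = 0.

(** The projection onto the common kernel of the functionals of b along the
    vectors of b, when b is biorthogonal. *)
Definition residual b x := x - \sum_(p <- b) p.2 x *: p.1.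

Lemma residual_cons e f b x : residual ((e, f) :: b) x = residual b x - f x *: e.
Proof. by rewrite /residual big_cons opprD addrCA addrC. Qed.

Lemma residual_id b x : annihilates b x -> residual b x = x.
Proof.
move=> bx; rewrite /residual big_seq big1 ?subr0// => p /bx ->.
by rewrite scale0r.
Qed.

Lemma residual_apply b f x : bounded_linear f ->
  (forall p, p \in b -> f p.1 = 0) -> f (residual b x) = f x.
Proof.
move=> bf fb; rewrite (bounded_linearB _ _ bf) (bounded_linear_sum _ _ bf).
rewrite big_seq big1 ?subr0// => p /fb fp.
by rewrite (bounded_linearZ _ _ bf) fp mulr0.
Qed.

Lemma residual_annihilates b x : biorthogonal b -> annihilates b (residual b x).
Proof.
elim: b => // -[e f] b IH [bf fe1 fb bb] p; rewrite residual_cons inE.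
move=> /predU1P[->/=|pb].
  rewrite (bounded_linearB _ _ bf) (bounded_linearZ _ _ bf) fe1 mulr1.
  by rewrite residual_apply ?subrr// => q /fb[].
have bp := biorthogonal_bounded bb pb.
rewrite (bounded_linearB _ _ bp) (bounded_linearZ _ _ bp) (IH bb _ pb).
by have [_ ->] := fb p pb; rewrite mulr0 subr0.
Qed.

Lemma residual_basis b p : biorthogonal b -> p \in b -> residual b p.1 = 0.
Proof.
elim: b => // -[e f] b IH [bf fe1 fb bb]; rewrite residual_cons inE.
move=> /predU1P[->/=|pb].
  by rewrite residual_id ?fe1 ?scale1r ?subrr// => q /fb[].
by rewrite IH//; have [-> _] := fb p pb; rewrite scale0r subr0.
Qed.

(** The constant C depends on b only: points at which the functionals of b
    are small are close to their common kernel. *)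
Lemma residual_close b : exists2 C, 0 <= C &
  forall x (r : R), (forall p, p \in b -> `|p.2 x| <= r) -> `|residual b x - x| <= C * r.
Proof.
exists (\sum_(p <- b) `|p.1|) => [|x r br]; first exact: sumr_ge0.
rewrite /residual addrAC subrr sub0r normrN (le_trans (ler_norm_sum _ _ _))//.
rewrite mulr_suml big_seq [leRHS]big_seq ler_sum// => p pb.
by rewrite normrZ mulrC ler_wpM2l// br.
Qed.

(** The new functional is the normalised composition of a functional norming y
    with the projection [residual b], which kills the vectors of b and fixes
    y. *)
Lemma biorthogonal_extend b y : biorthogonal b -> annihilates b y -> y != 0 ->
  exists f, biorthogonal ((y, f) :: b).
Proof.
move=> bb by0 y0; have [g [bg _ gy]] := norming_functional y.
exists (fun x => `|y|^-1 * (\sum_(p <- b) (- g p.1) * p.2 x + g x)).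
have E x : \sum_(p <- b) (- g p.1) * p.2 x + g x = g (residual b x).
  rewrite (bounded_linearB _ _ bg) (bounded_linear_sum _ _ bg) addrC -sumrN.
  by congr (_ + _); apply: eq_bigr => p _; rewrite (bounded_linearZ _ _ bg); ring.
split=> //.
- apply: bounded_linear_scale.
  have bs : bounded_linear (fun x => \sum_(p <- b) - g p.1 * p.2 x).
    by apply: bounded_linear_sumf => q; exact: biorthogonal_bounded.
  have := bounded_linear_comb 1 bs bg.
  by under eq_fun do rewrite mul1r.
- by rewrite E residual_id// gy mulVf// normr_eq0.
- by move=> p pb; split; [rewrite E residual_basis// bounded_linear0// mulr0|exact: by0].
Qed.

(** Gram-Schmidt without a scalar product. The conclusion says that s lies in
    the span of b, in the only form needed later. *)
Lemma biorthogonal_spanning (s : seq X) : exists2 b, biorthogonal b &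
  forall g, bounded_linear g -> (forall p, p \in b -> g p.1 = 0) ->
    forall x, x \in s -> g x = 0.
Proof.
elim: s => [|x s [b bb bs]]; first by exists [::].
have [r0|r0] := eqVneq (residual b x) 0.
  exists b => // g bg gb y; rewrite inE => /predU1P[->|]; last exact: bs.
  by rewrite -(residual_apply x bg gb) r0 bounded_linear0.
have [f bf] := biorthogonal_extend bb (residual_annihilates x bb) r0.
exists ((residual b x, f) :: b) => // g bg gb.
have gb' p : p \in b -> g p.1 = 0 by move=> pb; apply: gb; rewrite inE pb orbT.
move=> y; rewrite inE => /predU1P[->|]; last exact: bs.
by rewrite -(residual_apply x bg gb'); apply: (gb (_, f)); rewrite inE eqxx.
Qed.

Context (dX : daugavet X) (X_neq0 : exists v : X, v != 0).

(** Daugavet spaces are infinite-dimensional: by [daugavet_weak_nbhs], every weak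
    neighbourhood of 0 contains vectors of norm almost 1. *)
Lemma daugavet_annihilates_neq0 b : biorthogonal b ->
  exists2 y, y != 0 & annihilates b y.
Proof.
move=> bb; have [C C0 bC] := residual_close b.
pose r : R := (2 * (1 + C))^-1.
have C1 : 0 < 1 + C by rewrite ltr_pwDl.
have r0 : 0 < r by rewrite invr_gt0 mulr_gt0.
have rC : r + C * r = 2^-1.
  by rewrite -[X in X + _]mul1r -mulrDl /r invfM mulrCA mulfV ?mulr1// gt_eqF.
have [||y [y1 by0]] := @daugavet_weak_nbhs _ _ dX X_neq0 [seq p.2 | p <- b] 0 0 r _ _ r0.
- by move=> _ /mapP[p pb ->]; exact: biorthogonal_bounded pb.
- by rewrite normr0.
rewrite normr0 add0r sub0r normrN => yr.
exists (residual b y); last exact: residual_annihilates.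
have : `|residual b y - y| <= C * r.
  apply: bC => p pb; have bp := biorthogonal_bounded bb pb.
  have := by0 p.2; rewrite (bounded_linear0 bp) subr0; apply.
  exact: (map_f (fun p => p.2)).
apply: contraTneq => ->; rewrite sub0r normrN -ltNge.
have : (2 : R)^-1 < 1 by rewrite invf_lt1 ?ltr1n. 
lra.
Qed.

(** With a biorthogonal system spanning both s and the vectors of b, one more
    pair gives a functional f killing them all; projecting its vector makes the
    functionals of b vanish there, without changing the value of f. *)
Lemma daugavet_fresh_pair b (s : seq X) (r : R) : biorthogonal b -> 0 < r ->
  exists e f, [/\ biorthogonal ((e, f) :: b), `|e| <= r &
    forall x, x \in s -> f x = 0].
Proof.
move=> bb r0; have [c bc cs] := biorthogonal_spanning ([seq p.1 | p <- b] ++ s).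
have [y y0 cy] := daugavet_annihilates_neq0 bc.
have [f [bf fy1 fc _]] := biorthogonal_extend bc cy y0.
have f0 x : x \in [seq p.1 | p <- b] ++ s -> f x = 0.
  by apply: cs => // p /fc[].
have fb p : p \in b -> f p.1 = 0.
  by move=> pb; apply: f0; rewrite mem_cat (map_f (fun p => p.1)).
pose z := residual b y.
have fz1 : f z = 1 by rewrite residual_apply.
have z0 : 0 < `|z|.
  rewrite normr_gt0; apply: contra_eq_neq fz1 => ->.
  by rewrite bounded_linear0// eq_sym oner_neq0.
pose t := r / `|z|.
have t0 : 0 < t by rewrite divr_gt0.
exists (t *: z), (fun x => t^-1 * f x); split; first split=> //.
- exact: bounded_linear_scale.
- by rewrite (bounded_linearZ _ _ bf) fz1 mulr1 mulVf// gt_eqF.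
- move=> p pb; rewrite fb// mulr0; split=> //.
  have bp := biorthogonal_bounded bb pb.
  by rewrite (bounded_linearZ _ _ bp) residual_annihilates ?mulr0.
- by rewrite normrZ gtr0_norm// divfK// gt_eqF.
- by move=> x xs; rewrite f0 ?mulr0// mem_cat xs orbT.
Qed.

(** Points with small f-values for all f in b can be moved by a small vector
    into the common kernel, then scaled back into the unit ball. *)
Lemma daugavet_annihilates_nbhs b f x u (e : R) : biorthogonal b ->
  bounded_linear f -> (forall v, `|f v| <= `|v|) -> `|x| <= 1 -> annihilates b x -> 0 < e ->
  exists z, [/\ `|z| <= 1, annihilates b z, `|u| + 1 - e <= `|u - z| &
    f x - e <= f z].
Proof.
move=> bb bf fn x1 bx e0; have [C C0 bC] := residual_close b.
(* The distance to y is C r for the projection and C r for the rescaling. *)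
pose r : R := e / (1 + 2 * C).
have C1 : 0 < 1 + 2 * C by rewrite ltr_pwDl// mulr_ge0.
have r0 : 0 < r by rewrite divr_gt0.
have rC : r + 2 * (C * r) = e.
  by rewrite mulrA -[X in X + _]mul1r -mulrDl /r mulrC divfK// gt_eqF.
have [|y [y1 fy uy]] := @daugavet_weak_nbhs _ _ dX X_neq0
    (f :: [seq p.2 | p <- b]) x u r _ x1 r0.
  move=> g; rewrite inE => /predU1P[->//|/mapP[p pb ->]].
  exact: biorthogonal_bounded pb.
pose w := residual b y; pose c := 1 + C * r.
have c1 : 1 <= c by rewrite lerDl mulr_ge0// ltW.
have c0 : 0 < c by rewrite (lt_le_trans ltr01).
have wy : `|w - y| <= C * r.
  apply: bC => p pb; have := fy p.2; rewrite bx// subr0; apply.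
  by rewrite inE (map_f (fun p => p.2))// orbT.
have wc : `|w| <= c.
  by have := ler_normD (w - y) y; rewrite subrK /c; lra.
pose z := c^-1 *: w.
have zw : `|z - w| <= C * r.
  have -> : z - w = - ((1 - c^-1) *: w) by rewrite scalerBl scale1r [RHS]opprB.
  rewrite normrN normrZ ger0_norm; last by rewrite subr_ge0 invf_le1.
  rewrite (le_trans (ler_wpM2l _ wc))// ?subr_ge0 ?invf_le1//.
  by rewrite mulrBl mul1r mulVf ?gt_eqF// /c addrAC subrr add0r.
have zy : `|z - y| <= 2 * (C * r).
  by have := ler_normD (z - w) (w - y); rewrite addrA subrK; lra.
exists z; split.
- by rewrite normrZ gtr0_norm ?invr_gt0// ler_pdivrMl// mulr1.
- move=> p pb; have bp := biorthogonal_bounded bb pb.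
  by rewrite (bounded_linearZ _ _ bp) /w residual_annihilates ?mulr0.
- by have := ler_normB (u - z) (y - z); rewrite distrC in zy; rewrite opprB addrA subrK; lra.
- have := fy f (mem_head _ _); have := fn (z - y); rewrite (bounded_linearB _ _ bf).
  by rewrite !ler_norml => /andP[zy1 _] /andP[yx1 _]; lra.
Qed.

(** If x were at distance at least e from the convex hull of the points z
    described here, a functional would separate it from all of them,
    contradicting [daugavet_annihilates_nbhs].  The convex combination of points
    z close to x is recorded only through its effect on functionals, which is
    all that slices see. *)
Lemma daugavet_approx b x u (e : R) : biorthogonal b ->
  `|x| <= 1 -> annihilates b x -> 0 < e ->
  exists2 s : seq X,
    (forall z, z \in s ->
      [/\ `|z| <= 1, annihilates b z & `|u| + 1 - e <= `|u - z|]) &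
    forall h M, bounded_linear h -> 0 < M -> (forall v, `|h v| <= M * `|v|) ->
      exists2 z, z \in s & h x - M * e <= h z.
Proof.
move=> bb x1 bx e0.
pose Q := [set z : X | [/\ `|z| <= 1, annihilates b z & `|u| + 1 - e <= `|u - z|]].
pose G := [set x - z | z in Q].
have [a [v [av ve]]] : exists a v, conic_comb G a v /\ `|v| < a * e.
  apply: contrapT => nG; have [|f [bf fn fG]] := @separation _ _ G e.
    move=> a v av; rewrite leNgt; apply/negP => ve; apply: nG.
    by exists a, v.
  have [|z [z1 bz uz fz]] := daugavet_annihilates_nbhs u bb bf fn x1 bx (_ : 0 < e / 2).
    by rewrite divr_gt0.
  have : e <= f (x - z).
    apply: fG; exists z => //; split=> //; lra.
  rewrite (bounded_linearB _ _ bf); lra.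
have [s sG sm] := conic_comb_mean av.
exists [seq x - w | w <- s] => [_ /mapP[w ws ->]|h M bh M0 hM].
  by have [z Qz <-] := sG w ws; rewrite subKr.
apply: contrapT => nz.
have /sm-/(_ bh) : forall w, w \in s -> M * e <= h w.
  move=> w ws; rewrite leNgt; apply/negP => hw; apply: nz.
  exists (x - w); first exact: map_f.
  by rewrite (bounded_linearB _ _ bh) lerD2l lerN2 ltW.
move=> /le_trans/(_ (ler_norm _))/le_trans/(_ (hM v)).
by rewrite mulrCA ler_pM2l// leNgt ve.
Qed.

End Biorthogonal.

(** * The points and the biorthogonal pairs *)

Section Stages.
Context {R : realType} {X : normedModType R}.
Context (dX : daugavet X) (X_neq0 : exists v : X, v != 0).

(** [points] are the xi's chosen so far, [targets] the vectors
    x0 - y_0 - ... - y_(n-1) to which later points must be almost l1-orthogonal,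
    and [system] the pairs (e, f), the latest one first. *)
Record stage := Stage {
  points : seq X;
  targets : seq X;
  system : seq (X * (X -> R)) }.

Definition stage_rate (s : stage) : R := (size (system s)).+1%:R^-1.

Definition stage_inv (s : stage) : Prop :=
  biorthogonal (system s) /\
  forall x, x \in points s -> `|x| <= 1 /\ annihilates (system s) x.

Definition stage_next (s t : stage) : Prop :=
  [/\ {subset points s <= points t}, {subset targets s <= targets t},
      exists2 p, system t = p :: system s & `|p.1| <= stage_rate s,
      forall u z, u \in targets s -> z \in points t -> u - z \in targets t &
      forall x u, x \in points s -> u \in targets s ->
      forall h M, bounded_linear h -> 0 < M -> (forall v, `|h v| <= M * `|v|) ->
        exists z, [/\ z \in points t, `|u| + 1 - stage_rate s <= `|u - z| &
          h x - M * stage_rate s <= h z]].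

Lemma stage_step s : stage_inv s -> exists2 t, stage_inv t & stage_next s t.
Proof.
move=> [bs sP]; have r0 : 0 < stage_rate s by rewrite invr_gt0.
have /choice[Z ZP] : forall p : X * X, exists zs : seq X,
    `|p.1| <= 1 -> annihilates (system s) p.1 ->
    (forall z, z \in zs -> [/\ `|z| <= 1, annihilates (system s) z &
      `|p.2| + 1 - stage_rate s <= `|p.2 - z|]) /\
    (forall h M, bounded_linear h -> 0 < M -> (forall v, `|h v| <= M * `|v|) ->
      exists2 z, z \in zs & h p.1 - M * stage_rate s <= h z).
  move=> [x u] /=; have [[x1 bx]|nx] := pselect (`|x| <= 1 /\ annihilates (system s) x).
    have [zs zsP zsh] := daugavet_approx dX X_neq0 u bs x1 bx r0.
    by exists zs.
  by exists [::] => x1 bx; exfalso; apply: nx.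
pose L := points s ++ flatten [seq Z p | p <- [seq (x, u) | x <- points s, u <- targets s]].
have LP z : z \in L -> `|z| <= 1 /\ annihilates (system s) z.
  rewrite mem_cat => /orP[/sP//|/flattenP[_ /mapP[_ /allpairsP[[x u] /= [xs us ->] ->]]]].
  by have [x1 bx] := sP x xs; have [/= + _] := ZP (x, u) x1 bx => /[apply] -[].
have [e [f [bef e1 fL]]] := daugavet_fresh_pair dX X_neq0 L bs r0.
exists (Stage L (targets s ++ [seq u - z | u <- targets s, z <- L]) ((e, f) :: system s)).
  split=> // z zL; have [z1 bz] := LP z zL; split=> // p.
  by rewrite inE => /predU1P[->|]; [exact: fL|exact: bz].
split=> /=.
- by move=> x xs; rewrite mem_cat xs.
- by move=> x xs; rewrite mem_cat xs.
- by exists (e, f).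
- by move=> u z us zL; rewrite mem_cat; apply/orP; right; exact: allpairs_f.
- move=> x u xs us h M bh M0 hM; have [x1 bx] := sP x xs.
  have [/= Zz Zh] := ZP (x, u) x1 bx; have [z zZ hz] := Zh h M bh M0 hM.
  have [_ _ uz] := Zz z zZ; exists z; split=> //.
  rewrite mem_cat; apply/orP; right; apply/flattenP; exists (Z (x, u)) => //.
  by apply: map_f; exact: allpairs_f.
Qed.

Lemma stages s : stage_inv s -> exists2 S : nat -> stage, S 0 = s &
  forall n, stage_inv (S n) /\ stage_next (S n) (S n.+1).
Proof.
move=> si; have /choice[F FP] : forall s, exists t,
    stage_inv s -> stage_inv t /\ stage_next s t.
  move=> t; have [/stage_step[t' ? ?]|nt] := pselect (stage_inv t).
    by exists t'.
  by exists t.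
exists (fun n => iter n F s) => // n.
suff Si : stage_inv (iter n F s) by split=> //; have [] := FP _ Si.
by elim: n => // n IH; have [] := FP _ IH.
Qed.

End Stages.

Section DaugavetSequence.
Context {R : realType} {X : normedModType R}.

(** U stands for a set of vectors x0 - y_0 - ... - y_(n-1), where x0 and the y's are
    terms of xi; whenever xi_n lies in a slice of the hull of the sequence,
    [ds_approx] finds in the same slice some xi_k almost l1-orthogonal to a
    given member of U. *)
Record daugavet_sequence (U : set X) (xi : nat -> X) : Prop := {
  ds_norm : forall n, `|xi n| <= 1;
  ds_start : exists2 n, U (xi n) & `|xi n| = 1;
  ds_approx : forall n u h (r : R), U u -> bounded_linear h -> 0 < r ->
    exists k, [/\ U (u - xi k), `|u| + 1 - r <= `|u - xi k| &
      h (xi n) - r <= h (xi k)] }.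

Record biorthogonal_sequence (xi e : nat -> X) (f : nat -> X -> R) : Prop := {
  bs_linear : forall n, bounded_linear (f n);
  bs_diag : forall n, f n (e n) = 1;
  bs_offdiag : forall m n, m != n -> f m (e n) = 0;
  bs_annihilates : forall m n, f m (xi n) = 0;
  bs_small : forall n, `|e n| <= n.+1%:R^-1 }.

(** All pairs of a point and a target are treated at every later stage, with
    error 1 / (m + 1) at stage m, so every precision is eventually attained. *)
Lemma daugavet_sequence_exists : daugavet X -> (exists v : X, v != 0) ->
  exists U xi e f, daugavet_sequence U xi /\ biorthogonal_sequence xi e f.
Proof.
move=> dX X0; have [v v0] := X0.
pose x0 := `|v|^-1 *: v.
have x01 : `|x0| = 1 by rewrite normrZ normfV normr_id mulVf// normr_eq0.
have [|S S0 SP] := @stages _ _ dX X0 (Stage [:: x0] [:: x0] [::]).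
  by split=> // x; rewrite inE => /eqP ->; rewrite x01.
have incr (P : stage -> seq X) :
    (forall n, {subset P (S n) <= P (S n.+1)}) ->
    forall m n, (m <= n)%N -> {subset P (S m) <= P (S n)}.
  move=> PS m n mn; rewrite -(subnK mn); elim: (n - m)%N => // k IH x /IH.
  by rewrite addSn; exact: PS.
have pincr : forall m n, (m <= n)%N -> {subset points (S m) <= points (S n)}.
  by apply: incr => n; have [_ []] := SP n.
have tincr : forall m n, (m <= n)%N -> {subset targets (S m) <= targets (S n)}.
  by apply: incr => n; have [_ []] := SP n.
have x0S n : x0 \in points (S n) by apply: (pincr 0) => //; rewrite S0 inE.
(* The default value x0 is itself a point of every stage. *)
pose xi k := if unpickle k is Some (m, i) then nth x0 (points (S m)) i else x0.
have xiS k : exists m, xi k \in points (S m).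
  rewrite /xi; case: unpickle => [[m i]|]; last by exists 0.
  exists m; have [lt_i|ge_i] := ltnP i (size (points (S m))); first exact: mem_nth.
  by rewrite nth_default.
have Sxi m x : x \in points (S m) -> exists k, xi k = x.
  by move=> /(nthP x0)[i _ <-]; exists (pickle (m, i)); rewrite /xi pickleK.
have /choice[P PP] : forall n, exists p,
    system (S n.+1) = p :: system (S n) /\ `|p.1| <= stage_rate (S n).
  by move=> n; have [_ [_ _ [p]]] := SP n; exists p.
have sizeS n : size (system (S n)) = n.
  by elim: n => [|n IH]; rewrite ?S0//; have [-> _] := PP n; rewrite /= IH.
have PS m n : (m < n)%N -> P m \in system (S n).
  move=> mn; rewrite -(subnK mn); elim: (n - _)%N => [|k IH].
    by have [-> _] := PP m; rewrite inE eqxx.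
  by rewrite addSn; have [-> _] := PP (k + m.+1)%N; rewrite inE IH orbT.
have Pbi n : [/\ bounded_linear (P n).2, (P n).2 (P n).1 = 1 &
    forall p, p \in system (S n) -> (P n).2 p.1 = 0 /\ p.2 (P n).1 = 0].
  have [[bS _] _] := SP n.+1; have [E _] := PP n; rewrite E in bS.
  by move: bS; case: (P n) => e f [].
exists [set u | exists n, u \in targets (S n)], xi, (fun n => (P n).1), (fun n => (P n).2).
split; split.
- by move=> n; have [m xm] := xiS n; have [[_ Sx] _] := SP m; have [] := Sx _ xm.
- by have [k xk] := Sxi _ _ (x0S 0); exists k; rewrite xk//; exists 0; rewrite S0 inE.
- move=> n u h r [i ui] bh r0; have [m xm] := xiS n.
  have [M M0 hM] := bounded_linear_bound bh.
  pose c := r / (1 + M).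
  have c0 : 0 < c by rewrite divr_gt0// addr_gt0.
  have [j jc] : exists j : nat, c^-1 < j.+1%:R.
    by exists (Num.trunc c^-1); rewrite truncnS_gt.
  pose N := maxn (maxn i m) j.
  have uN : u \in targets (S N) by apply: tincr ui; rewrite /N !leq_max leqnn.
  have xN : xi n \in points (S N) by apply: pincr xm; rewrite /N !leq_max leqnn orbT.
  have [_ [_ _ _ UN NP]] := SP N; have [z [zN uz hz]] := NP _ _ xN uN h M bh M0 hM.
  have [k kz] := Sxi _ _ zN.
  have rc : stage_rate (S N) <= c.
    rewrite /stage_rate sizeS -[leRHS]invrK lef_pV2 ?posrE ?invr_gt0//.
    by rewrite (le_trans (ltW jc))// ler_nat ltnS leq_max leqnn orbT.
  have cr : c + M * c = r by rewrite -[X in X + _]mul1r -mulrDl mulrC divfK// gt_eqF// addr_gt0.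
  have Mc : M * stage_rate (S N) <= M * c by rewrite ler_wpM2l// ltW.
  have Mc0 : 0 < M * c by rewrite mulr_gt0.
  exists k; rewrite kz; split; [by exists N.+1; exact: UN|lra|lra].
- by move=> n; have [] := Pbi n.
- by move=> n; have [] := Pbi n.
- move=> m n; rewrite neq_ltn => /orP[] /PS.
    by have [_ _ /[apply] -[]] := Pbi n.
  by have [_ _ /[apply] -[]] := Pbi m.
- move=> m n; have [k xk] := xiS n.
  have [[_ /(_ (xi n))[]]] := SP (maxn m.+1 k).
    by apply: pincr xk; rewrite leq_maxr.
  by move=> _ /(_ (P m)) + _; apply; apply: PS; rewrite leq_maxl.
- by move=> n; have [_] := PP n; rewrite /stage_rate sizeS.
Qed.

End DaugavetSequence.

(** * Closed convex hulls *)

Section ClosedConvexHull.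
Context {R : realType} {X : normedModType R}.
Implicit Types (A B C : set X) (f g : X -> R) (x y : X).

Lemma convex_setE A : convex_set A <->
  forall x y (t : R), 0 <= t <= 1 -> A x -> A y -> A (t *: x + (1 - t) *: y).
Proof.
split=> [cA x y t t01 Ax Ay|cA x y t].
  have := cA x y (Itv01 (proj1 (andP t01)) (proj2 (andP t01))).
  by rewrite !inE => /(_ Ax Ay).
rewrite !inE => Ax Ay; apply: cA => //.
by apply/andP; split; [exact: ge0|exact: le1].
Qed.

Lemma closure_approx A x (e : R) : closure A x -> 0 < e ->
  exists2 a, A a & `|x - a| < e.
Proof.
move=> Ax e0; have [a [Aa]] := Ax _ (nbhsx_ballx x e e0).
by rewrite -ball_normE /= => xa; exists a.
Qed.

Lemma approx_closure A x :
  (forall e : R, 0 < e -> exists2 a, A a & `|x - a| < e) -> closure A x.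
Proof.
move=> xA B /nbhs_ballP[e e0 eB]; have [a Aa xa] := xA e e0.
by exists a; split=> //; apply: eB; rewrite -ball_normE.
Qed.

Lemma closure_convex A : convex_set A -> convex_set (closure A).
Proof.
move=> /convex_setE cA; apply/convex_setE => x y t /[dup] t01 /andP[t0 t1] Ax Ay.
apply: approx_closure => e e0.
have [a Aa xa] := closure_approx Ax e0; have [b Ab yb] := closure_approx Ay e0.
exists (t *: a + (1 - t) *: b); first exact: cA.
rewrite opprD addrACA -!scalerBr (le_lt_trans (ler_normD _ _))//.
rewrite !normrZ (ger0_norm t0) ger0_norm ?subr_ge0//.
have [->|t0'] := eqVneq t 0; first by rewrite mul0r add0r subr0 mul1r.
have tp : 0 < t by rewrite lt_neqAle eq_sym t0'.
have : t * `|x - a| < t * e by rewrite ltr_pM2l.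
have : (1 - t) * `|y - b| <= (1 - t) * e by rewrite ler_wpM2l ?subr_ge0// ltW.
lra.
Qed.

Lemma smallest_convex B : convex_set (smallest (@convex_set R X) B).
Proof.
apply/convex_setE => x y t t01 Bx By C [cC BC].
by move/convex_setE : (cC); apply=> //; [exact: Bx|exact: By].
Qed.

Lemma closed_conv_closed B : closed (closed_conv B).
Proof. exact: closed_closure. Qed.

Lemma closed_conv_convex B : convex_set (closed_conv B).
Proof. exact/closure_convex/smallest_convex. Qed.

Lemma sub_closed_conv B : B `<=` closed_conv B.
Proof. by move=> x Bx; apply: subset_closure; exact: sub_gen_smallest. Qed.

Lemma closed_conv_min B C : convex_set C -> closed C -> B `<=` C ->
  closed_conv B `<=` C.
Proof.
move=> cC clC BC; rewrite /closed_conv closureE => x; apply; split => //.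
exact: smallest_sub.
Qed.

Lemma closed_conv_mono A B : A `<=` closed_conv B -> closed_conv A `<=` closed_conv B.
Proof.
by move=> AB; apply: closed_conv_min => //;
  [exact: closed_conv_convex|exact: closed_conv_closed].
Qed.

(** Lipschitz convex functions pass upper bounds on to closed convex hulls. *)
Lemma closed_conv_le (g : X -> R) (K c : R) B :
  (forall x y t, 0 <= t <= 1 ->
    g (t *: x + (1 - t) *: y) <= t * g x + (1 - t) * g y) ->
  (forall x y, g x - g y <= K * `|x - y|) ->
  (forall x, B x -> g x <= c) -> forall x, closed_conv B x -> g x <= c.
Proof.
move=> cg lg Bc x; apply: (@closed_conv_min B [set x | g x <= c]) => //.
  apply/convex_setE => y z t /[dup] t01 /andP[t0 t1] /= yc zc.
  rewrite (le_trans (cg _ _ _ t01))//.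
  have : t * g y <= t * c by rewrite ler_wpM2l.
  have : (1 - t) * g z <= (1 - t) * c by rewrite ler_wpM2l// subr_ge0.
  lra.
move=> y yc /=; apply/ler_addgt0Pr => e e0.
have d0 : 0 < e / (1 + `|K|) by rewrite divr_gt0// ltr_pwDl.
have [z /= zc yz] := closure_approx yc d0.
rewrite -lerBlDl (le_trans (lerB (lexx _) zc))// (le_trans (lg _ _))//.
rewrite (le_trans (ler_norm _))// normrM normr_id.
rewrite (le_trans (ler_wpM2l (normr_ge0 _) (ltW yz)))// mulrCA -ler_pdivlMl//.
by rewrite mulVf ?gt_eqF// ler_pdivrMr ?ltr_pwDl// mul1r lerDr.
Qed.

Lemma closed_conv_le_linear f (c : R) B : bounded_linear f ->
  (forall x, B x -> f x <= c) -> forall x, closed_conv B x -> f x <= c.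
Proof.
move=> bf; have [M M0 fM] := bounded_linear_bound bf.
apply: (@closed_conv_le _ M) => [x y t _|x y].
  by rewrite (bounded_linearD _ _ bf) !(bounded_linearZ _ _ bf).
by rewrite -(bounded_linearB _ _ bf) (le_trans (ler_norm _)).
Qed.

Lemma closed_conv_bounded B (c : R) : (forall x, B x -> `|x| <= c) ->
  bounded_set (closed_conv B).
Proof.
move=> Bc; exists c; split; first exact: num_real.
move=> M /ltW cM x; apply: (@closed_conv_le _ 1) => [y z t /andP[t0 t1]|y z|y /Bc yc].
- rewrite (le_trans (ler_normD _ _))// !normrZ !ger0_norm ?subr_ge0//.
- by rewrite mul1r; have := ler_normD (y - z) z; rewrite subrK; lra.
- exact: le_trans cM.
Qed.

Lemma is_sliceP A f (r : R) : bounded_linear f -> (exists x, f x != 0) -> 0 < r ->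
  is_slice A (slice A f r).
Proof.
move=> bf [x fx] r0; have [g cg gE] := bounded_linear_bundle bf.
by exists g, r; rewrite gE in fx *; split=> //; exists x.
Qed.

End ClosedConvexHull.

(** * The hull of a Daugavet sequence is not SCD *)

Section NotScd.
Context {R : realType} {X : normedModType R} (U : set X) (xi : nat -> X).
Context (ds : daugavet_sequence U xi).

Let W := closed_conv (range xi).

Let xi_in n : W (xi n).
Proof. by apply: sub_closed_conv; exists n. Qed.

(** Half of the width of the slice is spent to find some xi_i in it, the other
    half to replace xi_i by an almost l1-orthogonal xi_k. *)
Lemma daugavet_sequence_slice S u (r : R) : is_slice W S -> U u -> 0 < r ->
  exists k, [/\ S (xi k), U (u - xi k) & `|u| + 1 - r <= `|u - xi k|].
Proof.
move=> [h [e [ch _ e0 ->]]] Uu r0; have bh := continuous_bounded_linear ch.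
have [i hi] : exists i, sup (h @` W) - e / 2 < h (xi i).
  apply: contrapT => nh.
  have hW x : W x -> h x <= sup (h @` W) - e / 2.
    apply: (closed_conv_le_linear bh) => _ [n _ <-].
    by rewrite leNgt; apply/negP => hn; apply: nh; exists n.
  have : sup (h @` W) <= sup (h @` W) - e / 2.
    by apply: ge_sup => [|_ [x Wx <-]]; [exists (h (xi 0)), (xi 0)|exact: hW].
  lra.
have m0 : 0 < Num.min (e / 2) r by rewrite lt_min r0 divr_gt0.
have [k [Uk uk hk]] := ds_approx ds i Uu bh m0.
have m1 : Num.min (e / 2) r <= e / 2 by rewrite ge_min lexx.
have m2 : Num.min (e / 2) r <= r by rewrite ge_min lexx orbT.
exists k; split=> //; last lra.
by split=> //=; lra.
Qed.

(** The points y_n are chosen so that u_n = x0 - y_0 - ... - y_(n-1) has norm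
    at least n + 1/2.  A functional of norm 1 attaining |u_n| at u_n is a sum of
    n + 1 terms of absolute value at most 1, hence is at least 1/2 at x0 and at
    most - 1/2 at each y_k. *)
Lemma daugavet_sequence_not_scd : ~ scd W.
Proof.
move=> [_ [S [Sl [_ Sdet]]]].
have half_gt0 : 0 < 2^-1 :> R by rewrite invr_gt0.
have /choice[F FP] : forall p : nat * X, exists k, U p.2 ->
    [/\ S p.1 (xi k), U (p.2 - xi k) &
      `|p.2| + 1 - 2^-1 ^+ p.1.+2 <= `|p.2 - xi k|].
  move=> [n u] /=; have [Uu|nU] := pselect (U u); last by exists 0.
  have [k kP] := daugavet_sequence_slice (Sl n) Uu (exprn_gt0 n.+2 half_gt0).
  by exists k.
have [i Ui xi1] := ds_start ds.
pose u := fix u n := if n is m.+1 then u m - xi (F (m, u m)) else xi i.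
pose y n := xi (F (n, u n)).
have Uu n : U (u n) by elim: n => // n IH; have [] := FP (n, u n) IH.
have uE n : u n = xi i - \sum_(k < n) y k.
  elim: n => [|n IH]; first by rewrite big_ord0 subr0.
  by rewrite big_ord_recr /= opprD addrA -IH.
have un n : n%:R + 2^-1 + 2^-1 ^+ n.+1 <= `|u n|.
  elim: n => [|n IH]; first by rewrite /= xi1 add0r expr1; lra.
  have [_ _ /=] := FP (n, u n) (Uu n); rewrite -/(y n) -(natr1 n) => H.
  have : (2^-1 : R) ^+ n.+2 = 2^-1 * 2^-1 ^+ n.+1 by rewrite exprS.
  by move: IH H; lra.
have u12 n : n%:R + 2^-1 <= `|u n|.
  by rewrite (le_trans _ (un n))// lerDl exprn_ge0// invr_ge0.
have /choice[phi phiP] : forall n, exists f : X -> R,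
    [/\ bounded_linear f, forall x, `|f x| <= `|x| & f (u n) = `|u n|].
  by move=> n; exact: norming_functional.
have phi1 n k : - 1 <= phi n (xi k) <= 1.
  have [_ pn _] := phiP n; rewrite -ler_norml.
  exact: le_trans (ds_norm ds k).
have phiu n : phi n (xi i) - \sum_(k < n) phi n (y k) = `|u n|.
  have [bp _ <-] := phiP n.
  by rewrite uE (bounded_linearB _ _ bp) (bounded_linear_sum _ _ bp).
have phix n : 2^-1 <= phi n (xi i).
  have : - n%:R <= \sum_(k < n) phi n (y k).
    rewrite -[n in - n%:R]card_ord -sumr_const -sumrN ler_sum// => k _.
    by have /andP[] := phi1 n (F (k : nat, u k)).
  by have := u12 n; have := phiu n; lra.
have phiy n k : (k < n)%N -> phi n (y k) <= 0.
  move=> kn; have := phiu n; rewrite (bigD1 (Ordinal kn))//=.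
  set s := \sum_(j < n | _) _.
  have : - (n%:R - 1) <= s.
    have -> : n%:R - 1 = \sum_(j < n | j != Ordinal kn) 1 :> R.
      by rewrite sumr_const cardC1 card_ord -subn1 natrB// (leq_ltn_trans _ kn).
    rewrite -sumrN ler_sum// => j _.
    by have /andP[] := phi1 n (F (j : nat, u j)).
  by have /andP[_] := phi1 n i; have := u12 n; lra.
(* Bounds on convex hulls come from convex sets containing the y's; here each
   y_k satisfies the condition from n = k + 1 on. *)
pose Z := [set b : X | exists N, forall n, (N <= n)%N -> phi n b <= 0].
have cZ : convex_set Z.
  apply/convex_setE => b c t /andP[t0 t1] [N Nb] [M Mc].
  exists (maxn N M) => n; rewrite geq_max => /andP[/Nb bn /Mc cn].
  have [bp _ _] := phiP n.
  rewrite (bounded_linearD _ _ bp) !(bounded_linearZ _ _ bp).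
  by rewrite -oppr_ge0 opprD -!mulrN addr_ge0// mulr_ge0// ?oppr_ge0// subr_ge0.
have yS : forall n, range y `&` S n !=set0.
  move=> n; exists (y n); split; first by exists n.
  by have [] := FP (n, u n) (Uu n).
have [b yb xb] := closure_approx (Sdet _ yS _ (@xi_in i)) half_gt0.
have [N NP] : Z b.
  apply: yb; split=> // _ [k _ <-]; exists k.+1 => n; exact: phiy.
have [bp pn _] := phiP N; have := pn (xi i - b).
rewrite (bounded_linearB _ _ bp).
have := ler_norm (phi N (xi i) - phi N b).
by have := NP N (leqnn N); have := phix N; move: xb; lra.
Qed.

End NotScd.

(** * Hulls of spikes *)

Section Spikes.
Context {R : realType} {X : normedModType R}.
Context (xi e : nat -> X) (f : nat -> X -> R).
Context (xi1 : forall n, `|xi n| <= 1) (bs : biorthogonal_sequence xi e f).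

(** The boolean selects the sign of e_n. *)
Definition spike (c : nat * bool) : X := xi c.1 + (-1) ^+ c.2 *: e c.1.

Definition spiky_hull : set X := closed_conv (range spike).

Definition spike_functional (c : nat * bool) (x : X) : R := (-1) ^+ c.2 * f c.1 x.

Lemma spike_in c : spiky_hull (spike c).
Proof. by apply: sub_closed_conv; exists c. Qed.

Lemma spike_functional_linear c : bounded_linear (spike_functional c).
Proof. exact: bounded_linear_scale (bs_linear bs _). Qed.

Lemma spike_functional_diag c : spike_functional c (spike c) = 1.
Proof.
rewrite /spike_functional /spike; have bf := bs_linear bs c.1.
rewrite (bounded_linearD _ _ bf) (bounded_linearZ _ _ bf).
by rewrite (bs_annihilates bs) (bs_diag bs) add0r mulr1 -expr2 sqrr_sign.
Qed.

Lemma spike_functional_offdiag c d : c != d -> spike_functional c (spike d) <= 0.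
Proof.
move: c d => [m s] [n t] cd; rewrite /spike_functional /spike /=.
have bf := bs_linear bs m; rewrite (bounded_linearD _ _ bf) (bounded_linearZ _ _ bf).
rewrite (bs_annihilates bs) add0r; have [mn|mn] := eqVneq m n; last first.
  by rewrite (bs_offdiag bs mn) !mulr0.
subst n; rewrite (bs_diag bs) mulr1 -signr_addb.
have -> : s (+) t by move: cd; rewrite xpair_eqE eqxx; case: s t => -[].
by rewrite expr1 lerN10.
Qed.

Lemma spike_base_norm n : `|e n| <= 1.
Proof.
by rewrite (le_trans (bs_small bs n))// invf_le1// ?ler1n// ltr0n.
Qed.

Lemma spike_norm c : `|spike c| <= 2.
Proof.
rewrite (le_trans (ler_normD _ _))// normrZ normr_sign mul1r.
by have := xi1 c.1; have := spike_base_norm c.1; lra.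
Qed.

(** The function x |-> |x - p| + 4 g x, for the spike p with its functional g,
    is convex, so its bound 4 on the spikes holds on their hull: it equals 4 at
    p, and on the other spikes g <= 0 and |x - p| <= 4. *)
Lemma spike_exposed c x : spiky_hull x ->
  `|x - spike c| <= 4 * (1 - spike_functional c x).
Proof.
have bf := spike_functional_linear c.
have [M M0 fM] := bounded_linear_bound bf.
suff H : spiky_hull x -> `|x - spike c| + 4 * spike_functional c x <= 4.
  by move=> /H; lra.
move: x; apply: (@closed_conv_le _ _ (fun x => `|x - spike c| + 4 * spike_functional c x)
    (1 + 4 * M)).
- move=> x y t /andP[t0 t1].
  have -> : t *: x + (1 - t) *: y - spike c =
      t *: (x - spike c) + (1 - t) *: (y - spike c).
    by rewrite !scalerBr addrACA -opprD -scalerDl [t + _]addrC subrK scale1r.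
  rewrite (bounded_linearD _ _ bf) !(bounded_linearZ _ _ bf).
  have := ler_normD (t *: (x - spike c)) ((1 - t) *: (y - spike c)).
  rewrite !normrZ (ger0_norm t0) (ger0_norm (_ : 0 <= 1 - t)) ?subr_ge0//.
  lra.
- move=> x y; have := ler_distD y x (spike c).
  have := fM (x - y); rewrite (bounded_linearB _ _ bf).
  have := ler_norm (spike_functional c x - spike_functional c y).
  lra.
- move=> _ [d _ <-]; have [<-|cd] := eqVneq c d.
    by rewrite subrr normr0 add0r spike_functional_diag mulr1.
  have := spike_functional_offdiag cd; have := ler_normB (spike d) (spike c).
  by have := spike_norm c; have := spike_norm d; lra.
Qed.

(** The slices of width 1 / (j + 1) given by the functionals of the spikes shrink
    to the spikes, so a set meeting them all has every spike in its closure. *)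
Lemma spiky_hull_scd : scd spiky_hull.
Proof.
have le1 c x : spiky_hull x -> spike_functional c x <= 1.
  by move=> /(spike_exposed c); have := normr_ge0 (x - spike c); lra.
have sup1 c : sup (spike_functional c @` spiky_hull) = 1.
  have c1 : (spike_functional c @` spiky_hull) 1.
    by exists (spike c); [exact: spike_in|exact: spike_functional_diag].
  apply/eqP; rewrite eq_le ge_sup ?ub_le_sup//; last 2 first.
  - by exists 1.
  - by move=> _ [x Ax <-]; exact: le1.
  by exists 1 => _ [x Ax <-]; exact: le1.
split; first by apply: (@closed_conv_bounded _ _ _ 2) => _ [c _ <-]; exact: spike_norm.
pose S c (j : nat) := slice spiky_hull (spike_functional c) j.+1%:R^-1.
exists (fun k => if unpickle k is Some (c, j) then S c j else S (0, true) 0); split.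
  have sS c j : is_slice spiky_hull (S c j).
    apply: is_sliceP; first exact: spike_functional_linear.
      by exists (spike c); rewrite spike_functional_diag oner_neq0.
    by rewrite invr_gt0.
  by move=> k; case: unpickle => [[c j]|]; exact: sS.
split.
  have S0 c j : S c j !=set0 /\ S c j `<=` spiky_hull.
    split; last by move=> x [].
    exists (spike c); split; first exact: spike_in.
    by rewrite sup1 spike_functional_diag ltrBlDr ltrDl invr_gt0.
  by move=> k; case: unpickle => [[c j]|]; exact: S0.
move=> B BS; apply: closed_conv_mono => _ [c _ <-].
have clB : closure B `<=` closed_conv B.
  by move=> x Bx; apply: closureS Bx; exact: sub_gen_smallest.
apply/clB/approx_closure => r r0.
have [j jr] : exists j : nat, 4 / r < j.+1%:R.
  by exists (Num.trunc (4 / r)); rewrite truncnS_gt.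
have [x [Bx]] := BS (pickle (c, j)); rewrite pickleK => -[Ax].
rewrite sup1 => fx; exists x => //; rewrite distrC (le_lt_trans (spike_exposed c Ax))//.
have : 4 * j.+1%:R^-1 < r by rewrite ltr_pdivrMr ?ltr0n// mulrC -ltr_pdivrMr.
by move: fx; set t := _^-1; lra.
Qed.

Lemma spiky_hull_base : closed_conv (range xi) `<=` spiky_hull.
Proof.
apply: closed_conv_mono => _ [n _ <-].
have /convex_setE cA := @closed_conv_convex _ _ (range spike).
have := cA _ _ 2^-1 _ (@spike_in (n, false)) (@spike_in (n, true)).
rewrite /spike /= expr0 expr1 scale1r scaleN1r.
have -> : 1 - 2^-1 = 2^-1 :> R by lra.
rewrite -scalerDr addrACA subrr addr0 -mulr2n -(scaler_nat 2 (xi n)) scalerA mulVf// scale1r.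
by apply; lra.
Qed.

(** The projection P = id - sum_(i <= K) f_i e_i fixes x.  It maps the first
    K + 1 pairs of spikes into the hull of the xi's and the other spikes within
    1 / (K + 1) of it; by convexity the same distance bound holds for x. *)
Lemma spiky_hull_kernel x : spiky_hull x -> (forall n, f n x = 0) ->
  closed_conv (range xi) x.
Proof.
move=> Ax fx0; set W := closed_conv (range xi).
have clW : closed W by exact: closed_conv_closed.
rewrite ((closure_id W).1 clW); apply: approx_closure => r r0.
have [K Kr] : exists K : nat, 2 / r < K.+1%:R.
  by exists (Num.trunc (2 / r)); rewrite truncnS_gt.
pose P y := y - \sum_(i < K.+1) f i y *: e i.
have PC y z t : P (t *: y + (1 - t) *: z) = t *: P y + (1 - t) *: P z.
  rewrite /P !scalerBr addrACA -opprD; congr (_ - _).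
  rewrite !scaler_sumr -big_split /=; apply: eq_bigr => i _.
  have bf := bs_linear bs i.
  by rewrite (bounded_linearD _ _ bf) !(bounded_linearZ _ _ bf) scalerDl !scalerA.
have [C C0 PL] : exists2 C, 0 < C & forall y z, `|P y - P z| <= C * `|y - z|.
  have [C C0 CP] : exists2 C, 0 <= C &
      forall y, `|\sum_(i < K.+1) f i y *: e i| <= C * `|y|.
    elim: K.+1 => [|k [C C0 CP]]; first by exists 0 => // y; rewrite big_ord0 normr0 mul0r.
    have [M M0 fM] := bounded_linear_bound (bs_linear bs k).
    exists (C + M) => [|y]; first by rewrite addr_ge0// ltW.
    rewrite big_ord_recr /= (le_trans (ler_normD _ _))// mulrDl lerD// normrZ.
    by rewrite -[leRHS]mulr1 ler_pM// spike_base_norm.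
  exists (1 + C) => [|y z]; first by rewrite ltr_pwDl.
  have -> : P y - P z = P (y - z).
    have fB (i : 'I_K.+1) : f i (y - z) *: e i = f i y *: e i - f i z *: e i.
      by rewrite (bounded_linearB _ _ (bs_linear bs i)) scalerBl.
    rewrite /P (eq_bigr _ (fun i _ => fB i)) sumrB !opprB addrACA [RHS]addrACA.
    by congr (_ + _); rewrite addrC.
  by rewrite (le_trans (ler_normB _ _))// mulrDl mul1r lerD2l.
pose N := [set y : X | exists2 w, W w & `|P y - w| <= K.+1%:R^-1].
have cN : convex_set N.
  apply/convex_setE => y z t /[dup] t01 /andP[t0 t1] [v Wv yv] [w Ww zw].
  exists (t *: v + (1 - t) *: w).
    by have /convex_setE cW := @closed_conv_convex _ _ (range xi); exact: cW.
  rewrite PC opprD addrACA -!scalerBr (le_trans (ler_normD _ _))//.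
  rewrite !normrZ (ger0_norm t0) (ger0_norm (_ : 0 <= 1 - t)) ?subr_ge0//.
  have : t * `|P y - v| <= t * K.+1%:R^-1 by rewrite ler_wpM2l.
  have : (1 - t) * `|P z - w| <= (1 - t) * K.+1%:R^-1.
    by rewrite ler_wpM2l// subr_ge0.
  by set k := K.+1%:R^-1; lra.
have PN : range spike `<=` N.
  move=> _ [[n s] _ <-]; exists (xi n); first by apply: sub_closed_conv; exists n.
  have fsp i : f i (spike (n, s)) = (-1) ^+ s * f i (e n).
    have bf := bs_linear bs i.
    by rewrite (bounded_linearD _ _ bf) (bounded_linearZ _ _ bf) (bs_annihilates bs) add0r.
  rewrite /P; have [nK|Kn] := ltnP n K.+1.
    rewrite (bigD1 (Ordinal nK))//= big1 => [|i iN]; last first.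
      by rewrite fsp (bs_offdiag bs) ?mulr0 ?scale0r.
    by rewrite fsp (bs_diag bs) mulr1 addr0 addrK subrr normr0 invr_ge0.
  rewrite big1 => [|i _]; last first.
    by rewrite fsp (bs_offdiag bs) ?mulr0 ?scale0r// neq_ltn (leq_trans (ltn_ord i)).
  rewrite subr0 /spike /= addrC addKr normrZ normr_sign mul1r.
  rewrite (le_trans (bs_small bs n))// lef_pV2 ?posrE ?ltr0n// ler_nat.
  by rewrite (leq_trans Kn).
have d0 : 0 < r / (2 * C) by rewrite divr_gt0// mulr_gt0.
have [y yN xy] := closure_approx Ax d0.
have [w Ww yw] := yN N (conj cN PN).
exists w => //; have <- : P x = x.
  by rewrite /P big1 ?subr0// => i _; rewrite fx0 scale0r.
have : C * `|x - y| < r / 2.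
  by rewrite -ltr_pdivlMl// mulrC -mulrA -invfM.
have : K.+1%:R^-1 < r / 2.
  by rewrite -[r / 2]invrK invf_div ltf_pV2 ?posrE ?ltr0n// divr_gt0.
have := PL x y; have := ler_distD (P y) (P x) w.
by move: yw; set k := K.+1%:R^-1; lra.
Qed.

End Spikes.

Lemma biorthogonal_sequence_reindex (R : realType) (X : normedModType R)
    (xi e : nat -> X) (f : nat -> X -> R) (s : nat -> nat) :
  biorthogonal_sequence xi e f -> injective s -> (forall n, n <= s n)%N ->
  biorthogonal_sequence xi (e \o s) (f \o s).
Proof.
move=> bs si ns; split=> /=.
- by move=> n; exact: (bs_linear bs).
- by move=> n; exact: (bs_diag bs).
- by move=> m n mn; rewrite (bs_offdiag bs)// (inj_eq si).
- by move=> m n; exact: (bs_annihilates bs).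
- move=> n; rewrite (le_trans (bs_small bs _))// lef_pV2 ?posrE ?ltr0n// ler_nat.
  by rewrite ltnS.
Qed.

Theorem theorem2p2 (R : realType) (X : completeNormedModType R) :
  (exists x : X, x != 0) -> daugavet X ->
  exists A D : set X,
    [/\ convex_set A, closed A & bounded_set A] /\
    [/\ convex_set D, closed D & bounded_set D] /\
    scd A /\ scd D /\
    (A `&` D !=set0 /\ ~ scd (A `&` D)).
Proof.
move=> X0 dX; have [U [xi [e [f [ds bs]]]]] := daugavet_sequence_exists dX X0.
have xi1 := ds_norm ds.
have bs0 : biorthogonal_sequence xi (e \o double) (f \o double).
  by apply: biorthogonal_sequence_reindex bs _ _ => [|n];
    [exact: double_inj|rewrite -addnn leq_addr].
have bs1 : biorthogonal_sequence xi (e \o (succn \o double)) (f \o (succn \o double)).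
  apply: biorthogonal_sequence_reindex bs _ _ => [m n [] /double_inj//|n].
  by rewrite /= -addnn -addnS leq_addr.
pose A := spiky_hull xi (e \o double).
pose D := spiky_hull xi (e \o (succn \o double)).
have scdA : scd A := spiky_hull_scd xi1 bs0.
have scdD : scd D := spiky_hull_scd xi1 bs1.
have AD : A `&` D = closed_conv (range xi).
  apply/seteqP; split=> [x [Ax Dx]|x Wx]; last by split; exact: spiky_hull_base Wx.
  apply: (spiky_hull_kernel bs0 Ax) => n /=.
  have bf := bs_linear bs n.*2.
  have f0 c : f n.*2 (spike xi (e \o (succn \o double)) c) = 0.
    rewrite (bounded_linearD _ _ bf) (bounded_linearZ _ _ bf) (bs_annihilates bs).
    rewrite (bs_offdiag bs) ?mulr0 ?addr0//=.
    by apply: contraTneq isT => /(congr1 odd); rewrite /= !odd_double.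
  apply/eqP; rewrite eq_le; apply/andP; split.
    by move: Dx; apply: (closed_conv_le_linear bf) => _ [c _ <-]; rewrite f0.
  rewrite -oppr_le0 -mulN1r; move: Dx.
  apply: (closed_conv_le_linear (bounded_linear_scale (-1) bf)) => _ [c _ <-].
  by rewrite f0 mulr0.
exists A, D; split; [|split; [|split; [|split]]] => //.
- by split; [exact: closed_conv_convex|exact: closed_conv_closed|case: scdA].
- by split; [exact: closed_conv_convex|exact: closed_conv_closed|case: scdD].
rewrite AD; split; last exact: daugavet_sequence_not_scd ds.
by exists (xi 0); apply: sub_closed_conv; exists 0.
Qed.
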